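(* Let $(\Omega,\mu)$ be a non-atomic infinite measure space and let $p(\cdot),q(\cdot)$ be exponents on $\Omega$. If the inclusion $L^{p(\cdot)}(\mu)\hookrightarrow L^{q(\cdot)}(\mu)$ holds, then it is not disjointly strictly singular.
   Context: ''Infinite measure space'' means $\mu(\Omega)=\infty$; non-atomic means that every measurable set $A$ with $\mu(A)>0$ contains a measurable set $B$ with $0<\mu(B)<\mu(A)$. An exponent on $\Omega$ is a real measurable function $p$ with $1\le p(t)<\infty$ (possibly unbounded). The variable Lebesgue space $L^{p(\cdot)}(\mu)$ is the space of all (classes of) real measurable $f$ on $\Omega$ such that $\rho_{p(\cdot)}(f/r)<\infty$ for some $r>0$, where $\rho_{p(\cdot)}(f)=\int_\Omega |f(t)|^{p(t)}d\mu$, with the Luxemburg norm $\|f\|_{p(\cdot)}=\inf\{r>0:\rho_{p(\cdot)}(f/r)\le 1\}$. ''The inclusion $L^{p(\cdot)}(\mu)\hookrightarrow L^{q(\cdot)}(\mu)$ holds'' means $L^{p(\cdot)}(\mu)\subset L^{q(\cdot)}(\mu)$ with continuous inclusion operator. An operator $T:E\to F$ from a Banach lattice $E$ to a Banach space $F$ is disjointly strictly singular (DSS) if there is no normalized pairwise disjoint sequence $(f_n)$ in $E$ such that the restriction of $T$ to the closed linear span $[f_n]$ is an isomorphism onto its image. *)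

(* Defs.v *)
From HB Require Import structures.
From mathcomp Require Import all_boot all_order all_algebra generic_quotient.
From mathcomp Require Import all_classical all_reals all_analysis measurable_realfun.
From mathcomp Require Import ring lra.
Set Implicit Arguments.
Unset Strict Implicit.
Unset Printing Implicit Defensive.
Import Order.TTheory GRing.Theory Num.Theory numFieldNormedType.Exports.
Local Open Scope classical_set_scope.
Local Open Scope ring_scope.

(* The order is carried by the mixin itself: Hierarchy-Builder refuses a
   structure joining Order.Lattice with GRing.Lmodule, because realDomainType
   already inherits from lattices and zmodules without declaring their join. *)
HB.mixin Record isBanachLattice (R : realType) E & CompleteNormedModule R E := {
  lat_le : E -> E -> Prop ;
  lat_meet : E -> E -> E ;
  lat_join : E -> E -> E ;
  lat_le_refl : forall x, lat_le x x ;
  lat_le_anti : forall x y, lat_le x y -> lat_le y x -> x = y ;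
  lat_le_trans : forall y x z, lat_le x y -> lat_le y z -> lat_le x z ;
  lat_meetP : forall x y z, lat_le x (lat_meet y z) <-> lat_le x y /\ lat_le x z ;
  lat_joinP : forall x y z, lat_le (lat_join x y) z <-> lat_le x z /\ lat_le y z ;
  lat_leD : forall x y z, lat_le x y -> lat_le (x + z) (y + z) ;
  lat_leZ : forall (a : R) x, 0 <= a -> lat_le 0 x -> lat_le 0 (a *: x) ;
  lat_norm_le : forall x y,
    lat_le (lat_join x (- x)) (lat_join y (- y)) -> `|x| <= `|y| }.

#[short(type="banachLatticeType")]
HB.structure Definition BanachLattice (R : realType) :=
  {E of isBanachLattice R E & CompleteNormedModule R E}.

Section disjointly_strictly_singular.
Context {R : realType} {E : banachLatticeType R}.

Definition lat_abs (x : E) : E := lat_join x (- x).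

Definition lat_disjoint (x y : E) : Prop := lat_meet (lat_abs x) (lat_abs y) = 0.

Definition closed_span (f : nat -> E) : set E :=
  closure [set x | exists n (a : nat -> R), x = \sum_(i < n) a i *: f i].

(* For linear T and a subspace A: the restriction of T to A is a linear
   homeomorphism onto T @` A. *)
Definition isomorphism_on {F : completeNormedModType R} (T : E -> F) (A : set E)
    : Prop :=
  {within A, continuous T} /\
  exists2 S : F -> E, forall x, A x -> S (T x) = x & {within T @` A, continuous S}.

Definition disjointly_strictly_singular {F : completeNormedModType R}
    (T : {linear E -> F}) : Prop :=
  ~ exists f : nat -> E,
    [/\ forall n, `|f n| = 1,
        forall n m, n != m -> lat_disjoint (f n) (f m) &
        isomorphism_on T (closed_span f)].

End disjointly_strictly_singular.

Section L0.
Context {d : measure_display} {T : measurableType d} {R : realType}.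
Variable mu : {measure set T -> \bar R}.

(* Measurable functions modulo almost everywhere equality. An element is applied
   to a point through its canonical representative, so pointwise properties are
   only meaningful almost everywhere. *)
Definition L0 : Type := {mfun_ mu, T >-> R}.
HB.instance Definition _ := Choice.on L0.

Definition L0_fun (x : L0) : T -> R := repr x.
Coercion L0_fun : L0 >-> Funclass.

Lemma measurable_L0 (x : L0) : measurable_fun setT x.
Proof. exact: measurable_funPT. Qed.
Lemma L0_eqP (x y : L0) : {ae mu, forall t, x t = y t} <-> x = y.
Proof.
split=> [xy|->]; last by apply: aeW.
rewrite -[x]reprK -[y]reprK; apply/eqmodP/asboolP.
by apply: filterS xy.
Qed.

Section mk.
Variables (f : T -> R) (mf : measurable_fun setT f).
HB.instance Definition _ := @isMeasurableFun.Build _ _ T R f mf.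
Definition L0_mk : L0 :=
  locked (\pi_({mfun_ mu, T >-> R})%qT (f : {mfun T >-> R})).

Lemma L0_mkE : {ae mu, forall t, L0_mk t = f t}.
Proof.
have /eqmodP/asboolP : (repr L0_mk = f %[mod {mfun_ mu, T >-> R}])%qT.
  by rewrite reprK /L0_mk -lock.
by apply: filterS => t /(_ I).
Qed.
End mk.

Section algebra.
Implicit Types (x y z : L0) (a b : R).

Definition L0_zero : L0 := L0_mk (@measurable_cst _ _ T R setT 0).
Definition L0_opp x : L0 :=
  L0_mk (measurable_funN (measurable_L0 x)).
Definition L0_add x y : L0 :=
  L0_mk (measurable_funD (measurable_L0 x) (measurable_L0 y)).
Definition L0_scale a x : L0 :=
  L0_mk (measurable_funM (measurable_cst a) (measurable_L0 x)).

Let addE x y : {ae mu, forall t, L0_add x y t = x t + y t}.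
Proof. exact: L0_mkE. Qed.
Let scaleE a x : {ae mu, forall t, L0_scale a x t = a * x t}.
Proof. exact: L0_mkE. Qed.
Let oppE x : {ae mu, forall t, L0_opp x t = - x t}.
Proof. exact: L0_mkE. Qed.
Let zeroE : {ae mu, forall t, L0_zero t = 0}.
Proof. exact: L0_mkE. Qed.

Let addA : associative L0_add.
Proof.
move=> x y z; apply/L0_eqP.
apply: filter_app (addE x (L0_add y z)); apply: filter_app (addE y z).
apply: filter_app (addE (L0_add x y) z); apply: filter_app (addE x y).
by apply: aeW => t /= h1 h2 h3 h4; rewrite h4 h3 h2 h1 addrA.
Qed.

Let addC : commutative L0_add.
Proof.
move=> x y; apply/L0_eqP.
apply: filter_app (addE x y); apply: filter_app (addE y x).
by apply: aeW => t /= -> ->; rewrite addrC.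
Qed.

Let add0 : left_id L0_zero L0_add.
Proof.
move=> x; apply/L0_eqP.
apply: filter_app (addE L0_zero x); apply: filter_app zeroE.
by apply: aeW => t /= h1 ->; rewrite h1 add0r.
Qed.

Let addN : left_inverse L0_zero L0_opp L0_add.
Proof.
move=> x; apply/L0_eqP.
apply: filter_app (addE (L0_opp x) x); apply: filter_app (oppE x).
apply: filter_app zeroE.
by apply: aeW => t /= -> h1 ->; rewrite h1 addNr.
Qed.

HB.instance Definition _ := GRing.isZmodule.Build L0 addA addC add0 addN.

Lemma L0_addE x y : {ae mu, forall t, (x + y : L0) t = x t + y t}.
Proof. exact: addE. Qed.
Lemma L0_oppE x : {ae mu, forall t, (- x : L0) t = - x t}.
Proof. exact: oppE. Qed.
Lemma L0_zeroE : {ae mu, forall t, (0 : L0) t = 0}.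
Proof. exact: zeroE. Qed.

Let scaleA a b x : L0_scale a (L0_scale b x) = L0_scale (a * b) x.
Proof.
apply/L0_eqP; apply: filter_app (scaleE a (L0_scale b x)).
apply: filter_app (scaleE b x); apply: filter_app (scaleE (a * b) x).
by apply: aeW => t /= -> h ->; rewrite h mulrA.
Qed.

Let scale1 : left_id 1 L0_scale.
Proof.
move=> x; apply/L0_eqP; apply: filter_app (scaleE 1 x).
by apply: aeW => t /= ->; rewrite mul1r.
Qed.

Let scaleDr : right_distributive L0_scale +%R.
Proof.
move=> a x y; apply/L0_eqP; apply: filter_app (scaleE a (x + y)).
apply: filter_app (scaleE a x); apply: filter_app (scaleE a y).
apply: filter_app (L0_addE x y).
apply: filter_app (L0_addE (L0_scale a x) (L0_scale a y)).
by apply: aeW => t /= -> h -> -> ->; rewrite h mulrDr.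
Qed.

Let scaleDl x : {morph L0_scale^~ x : a b / a + b}.
Proof.
move=> a b; apply/L0_eqP; apply: filter_app (scaleE (a + b) x).
apply: filter_app (scaleE a x); apply: filter_app (scaleE b x).
apply: filter_app (L0_addE (L0_scale a x) (L0_scale b x)).
by apply: aeW => t /= -> -> -> ->; rewrite mulrDl.
Qed.

HB.instance Definition _ := GRing.Zmodule_isLmodule.Build R L0
  scaleA scale1 scaleDr scaleDl.

Lemma L0_scaleE a x : {ae mu, forall t, (a *: x : L0) t = a * x t}.
Proof. exact: scaleE. Qed.

End algebra.

Section order.
Implicit Types x y z : L0.

Definition L0_le x y : Prop := {ae mu, forall t, x t <= y t}.
Definition L0_meet x y : L0 :=
  L0_mk (measurable_minr (measurable_L0 x) (measurable_L0 y)).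
Definition L0_join x y : L0 :=
  L0_mk (measurable_maxr (measurable_L0 x) (measurable_L0 y)).

Lemma L0_meetE x y : {ae mu, forall t, L0_meet x y t = Num.min (x t) (y t)}.
Proof. exact: L0_mkE. Qed.

Lemma L0_joinE x y : {ae mu, forall t, L0_join x y t = Num.max (x t) (y t)}.
Proof. exact: L0_mkE. Qed.

Lemma L0_absE x : {ae mu, forall t, L0_join x (- x) t = `|x t|}.
Proof.
apply: filter_app (L0_joinE x (- x)); apply: filter_app (L0_oppE x).
apply: aeW => t /= -> ->.
by have [k|k] := ltP (x t) (- x t); have [h|h] := ger0P (x t); lra.
Qed.

Lemma L0_le_refl x : L0_le x x.
Proof. exact: aeW. Qed.

Lemma L0_le_anti x y : L0_le x y -> L0_le y x -> x = y.
Proof.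
move=> xy yx; apply/L0_eqP.
apply: filter_app xy; apply: filter_app yx.
by apply: aeW => t /= h1 h2; apply/le_anti; rewrite h1 h2.
Qed.

Lemma L0_le_trans y x z : L0_le x y -> L0_le y z -> L0_le x z.
Proof.
move=> xy yz; apply: filter_app xy; apply: filter_app yz.
by apply: aeW => t /= h1 h2; exact: le_trans h1.
Qed.

Lemma L0_meetP x y z : L0_le x (L0_meet y z) <-> L0_le x y /\ L0_le x z.
Proof.
split=> [h|[h k]].
  split; apply: filter_app h; apply: filter_app (L0_meetE y z);
  by apply: aeW => t /= ->; rewrite le_min => /andP[].
apply: filter_app h; apply: filter_app k.
apply: filter_app (L0_meetE y z); apply: aeW => t /= -> h k.
by rewrite le_min h k.
Qed.

Lemma L0_joinP x y z : L0_le (L0_join x y) z <-> L0_le x z /\ L0_le y z.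
Proof.
split=> [h|[h k]].
  split; apply: filter_app h; apply: filter_app (L0_joinE x y);
  by apply: aeW => t /= ->; rewrite ge_max => /andP[].
apply: filter_app h; apply: filter_app k.
apply: filter_app (L0_joinE x y); apply: aeW => t /= -> h k.
by rewrite ge_max h k.
Qed.

Lemma L0_leD x y z : L0_le x y -> L0_le (x + z) (y + z).
Proof.
move=> xy; apply: filter_app xy; apply: filter_app (L0_addE x z).
by apply: filter_app (L0_addE y z); apply: aeW => t /= -> -> h; rewrite lerD2r.
Qed.

Lemma L0_leZ a x : 0 <= a -> L0_le 0 x -> L0_le 0 (a *: x).
Proof.
move=> a0 x0; apply: filter_app x0; apply: filter_app (L0_scaleE a x).
by apply: filter_app L0_zeroE; apply: aeW => t /= -> -> h; rewrite mulr_ge0.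
Qed.

End order.
End L0.

Record exponent {d : measure_display} (T : measurableType d) (R : realType) := Exponent {
  exponent_fun :> T -> R;
  measurable_exponent : measurable_fun setT exponent_fun;
  exponent_ge1 : forall t, 1 <= exponent_fun t }.

HB.lock Definition modular {d : measure_display} {T : measurableType d}
    {R : realType} (mu : {measure set T -> \bar R}) (p : exponent T R)
    (f : T -> R) : \bar R :=
  (\int[mu]_t (`|f t| `^ p t)%:E)%E.
Canonical modular_unlockable := Unlockable modular.unlock.

Section modular.
Context {d : measure_display} {T : measurableType d} {R : realType}.
Variables (mu : {measure set T -> \bar R}) (p : exponent T R).
Implicit Types (f g : T -> R) (r s : R).

Local Notation modular := (modular mu p).

Definition luxemburg_radii f : set R :=
  [set r | 0 < r /\ (modular (fun t => (f t / r)%R) <= 1)%E].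

(* inf set0 = 0, but the set of radii is nonempty on L^{p(.)} (Lvar_radii). *)
Definition luxemburg_norm f : R := inf (luxemburg_radii f).

Let p_ge0 t : 0 <= p t.
Proof. exact: le_trans (exponent_ge1 p t). Qed.

Lemma measurable_normr_powR f : measurable_fun setT f ->
  measurable_fun setT (fun t => `|f t| `^ p t).
Proof.
move=> mf; have mp := measurable_exponent p.
have mnf : measurable_fun setT (fun t => `|f t|) by exact: measurableT_comp.
rewrite /powR; apply: measurable_fun_ifT.
- by apply: measurable_fun_eqr => //; exact: measurable_cst.
- rewrite [X in measurable_fun _ X](_ : _ = cst 0); first exact: measurable_cst.
  by apply/funext => t /=; rewrite gt_eqF// (lt_le_trans ltr01 (exponent_ge1 p t)).
- apply: measurableT_comp; first exact: measurable_expR.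
  apply: measurable_funM => //.
  by apply: measurableT_comp => //; exact: measurable_ln.
Qed.

Let emeas f : measurable_fun setT f ->
  measurable_fun setT (fun t => (`|f t| `^ p t)%:E).
Proof. by move=> mf; apply/measurable_EFinP; exact: measurable_normr_powR. Qed.

Let ege0 f t : (0 <= (`|f t| `^ p t)%:E)%E.
Proof. by rewrite lee_fin powR_ge0. Qed.

Lemma modular_ge0 f : (0 <= modular f)%E.
Proof. by rewrite unlock; apply: integral_ge0 => t _. Qed.

Lemma modular_le f g : measurable_fun setT f -> measurable_fun setT g ->
  {ae mu, forall t, `|f t| <= `|g t|} -> (modular f <= modular g)%E.
Proof.
move=> mf mg fg; rewrite unlock.
apply: ae_ge0_le_integral => //; try exact: emeas.
apply: filterS fg => t fg _; rewrite lee_fin.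
by apply: ge0_ler_powR => //; rewrite nnegrE.
Qed.

Lemma modular_eq f g : measurable_fun setT f -> measurable_fun setT g ->
  {ae mu, forall t, `|f t| = `|g t|} -> modular f = modular g.
Proof.
move=> mf mg fg; apply/eqP; rewrite eq_le; apply/andP; split;
  apply: modular_le => //; apply: filterS fg => t ->; exact: lexx.
Qed.

Lemma modular0 : modular (fun=> 0) = 0%E.
Proof.
rewrite unlock (eq_integral (cst 0%E)) ?integral0// => t _ /=.
by rewrite normr0 powR0// gt_eqF// (lt_le_trans ltr01 (exponent_ge1 p t)).
Qed.

Let cvx (a x y q : R) : 1 <= q -> 0 <= a -> a <= 1 ->
  `|a * x + (1 - a) * y| `^ q <= a * `|x| `^ q + (1 - a) * `|y| `^ q.
Proof.
move=> q1 a0 a1.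
have q0 : 0 <= q by exact: le_trans q1.
have b0 : 0 <= 1 - a by rewrite subr_ge0.
have := @convex_powR _ _ q1 (Itv01 a0 a1) `|x| `|y|.
rewrite !inE/= !in_itv/= !normr_ge0/= => /(_ isT isT).
rewrite !convRE/= /unstable.onem; apply: le_trans.
apply: ge0_ler_powR => //; rewrite ?nnegrE// ?addr_ge0 ?mulr_ge0//.
rewrite (le_trans (ler_normD _ _))// !normrM.
by rewrite (ger0_norm a0) (ger0_norm b0).
Qed.

Lemma modular_convex f g (a : R) : measurable_fun setT f ->
  measurable_fun setT g -> 0 <= a -> a <= 1 ->
  (modular (fun t => (a * f t + (1 - a) * g t)%R)
    <= a%:E * modular f + (1 - a)%:E * modular g)%E.
Proof.
move=> mf mg a0 a1.
have b0 : 0 <= 1 - a by rewrite subr_ge0.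
have mF := emeas mf; have mG := emeas mg.
rewrite unlock -!ge0_integralZl_EFin// -ge0_integralD//.
- apply: ge0_le_integral => //.
  + apply: (emeas (f := fun t => a * f t + (1 - a) * g t)).
    by apply: measurable_funD; apply: measurable_funM.
  + by apply: emeasurable_funD; apply: emeasurable_funM.
  + move=> t _; rewrite -!EFinM -EFinD lee_fin.
    exact/cvx/a1/a0/exponent_ge1.
- by move=> t _; rewrite mule_ge0.
- exact: emeasurable_funM.
- by move=> t _; rewrite mule_ge0.
- exact: emeasurable_funM.
Qed.

Lemma modularZ f (a : R) : measurable_fun setT f -> 0 <= a -> a <= 1 ->
  (modular (fun t => (a * f t)%R) <= a%:E * modular f)%E.
Proof.
move=> mf a0 a1.
have /= := modular_convex mf (@measurable_cst _ _ T R setT 0) a0 a1.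
rewrite modular0 mule0 adde0 (_ : (fun t => a * f t + (1 - a) * 0) = (fun t => a * f t))//.
by apply/funext => t; rewrite mulr0 addr0.
Qed.

Lemma modular_eq0 f : measurable_fun setT f -> modular f = 0%E ->
  {ae mu, forall t, f t = 0}.
Proof.
move=> mf f0.
have /(ae_eq_integral_abs mu measurableT (emeas mf)) : 
    (\int[mu]_(t in setT) `|(`|f t| `^ p t)%:E|)%E = 0%E.
  by rewrite -[RHS]f0 unlock; apply: eq_integral => t _; rewrite gee0_abs.
apply: filterS => t /(_ I) /= [] /eqP.
by rewrite powR_eq0 normr_eq0 => /andP[/eqP].
Qed.

Let mdiv f r : measurable_fun setT f -> measurable_fun setT (fun t => f t / r).
Proof. by move=> mf; apply: measurable_funM. Qed.

Lemma luxemburg_radii_le f g r s : measurable_fun setT f ->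
  measurable_fun setT g -> {ae mu, forall t, `|f t| <= `|g t|} -> r <= s ->
  luxemburg_radii g r -> luxemburg_radii f s.
Proof.
move=> mf mg fg rs [r0 gr]; have s0 : 0 < s by exact: lt_le_trans rs.
split => //; apply: le_trans gr; apply: modular_le; try exact: mdiv.
apply: filterS fg => t fg; rewrite !normrM !normfV (gtr0_norm r0) (gtr0_norm s0).
by apply: ler_pM; rewrite ?invr_ge0 ?(ltW s0)// lef_pV2.
Qed.

Lemma luxemburg_radiiD f g r s : measurable_fun setT f ->
  measurable_fun setT g -> luxemburg_radii f r -> luxemburg_radii g s ->
  luxemburg_radii (fun t => f t + g t) (r + s).
Proof.
move=> mf mg [r0 fr] [s0 gs]; have rs0 : 0 < r + s by rewrite addr_gt0.
split => //.
pose a := r / (r + s).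
have a0 : 0 <= a by rewrite divr_ge0// ltW.
have a1 : a <= 1 by rewrite ler_pdivrMr// mul1r lerDl ltW.
have -> : (fun t => (f t + g t) / (r + s)) =
    (fun t => a * (f t / r) + (1 - a) * (g t / s)).
  by apply/funext => t; rewrite /a; field; rewrite !gt_eqF.
apply: le_trans (modular_convex (mdiv r mf) (mdiv s mg) a0 a1) _.
have -> : (1%E = a%:E * 1 + (1 - a)%:E * 1 :> \bar R)%E.
  by rewrite !mule1 -EFinD addrC subrK.
by apply: leeD; apply: lee_pmul => //; rewrite ?modular_ge0// lee_fin subr_ge0.
Qed.

Lemma luxemburg_radiiZ f r (a : R) : a != 0 ->
  luxemburg_radii f r -> luxemburg_radii (fun t => a * f t) (`|a| * r).
Proof.
move=> a0 [r0 fr]; have na0 : 0 < `|a| by rewrite normr_gt0.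
split; first by rewrite mulr_gt0.
apply: le_trans fr; rewrite le_eqVlt; apply/orP; left; apply/eqP.
rewrite unlock; apply: eq_integral => t _; congr (_ `^ _)%:E.
rewrite !normrM !normfV !normrM normr_id.
by rewrite invfM mulrACA divff ?gt_eqF// mul1r.
Qed.

Lemma has_lbound_luxemburg f : has_lbound (luxemburg_radii f).
Proof. by exists 0 => r [/ltW]. Qed.

Lemma luxemburg_norm_le f r : luxemburg_radii f r -> luxemburg_norm f <= r.
Proof. by move=> fr; apply: ge_inf => //; exact: has_lbound_luxemburg. Qed.

Lemma luxemburg_norm_lt f r : measurable_fun setT f ->
  luxemburg_radii f !=set0 -> luxemburg_norm f < r -> luxemburg_radii f r.
Proof.
move=> mf f0; rewrite -subr_gt0 => fr.
have [//|s fs] := inf_adherent fr (E := luxemburg_radii f).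
  by split => //; exact: has_lbound_luxemburg.
rewrite addrC subrK => /ltW sr.
by apply: luxemburg_radii_le fs => //; exact: aeW.
Qed.

Lemma luxemburg_radii_nonempty f r : measurable_fun setT f -> 0 < r ->
  (modular (fun t => (f t / r)%R) < +oo)%E -> luxemburg_radii f !=set0.
Proof.
move=> mf r0 fr.
pose M := fine (modular (fun t => f t / r)).
have EM : modular (fun t => f t / r) = M%:E.
  by rewrite fineK// ge0_fin_numE ?modular_ge0.
have M0 : 0 <= M by rewrite fine_ge0// modular_ge0.
have M1 : 0 < M + 1 by rewrite ltr_wpDl.
exists ((M + 1) * r); split; first by rewrite mulr_gt0.
have -> : (fun t => f t / ((M + 1) * r)) = (fun t => (M + 1)^-1 * (f t / r)).
  by apply/funext => t; rewrite invfM mulrCA.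
apply: le_trans (modularZ (mdiv r mf) _ _) _.
- by rewrite invr_ge0 ltW.
- by rewrite invf_le1// lerDr.
- by rewrite EM -EFinM lee_fin mulrC ler_pdivrMr// mul1r lerDl.
Qed.

Lemma luxemburg_norm_ge0 f : 0 <= luxemburg_norm f.
Proof.
have [f0|/set0P f0] := eqVneq (luxemburg_radii f) set0.
  by rewrite /luxemburg_norm f0 inf0.
by apply: lb_le_inf => // r [/ltW].
Qed.

Lemma luxemburg_radii_eq0 f : measurable_fun setT f ->
  (forall r, 0 < r -> luxemburg_radii f r) -> {ae mu, forall t, f t = 0}.
Proof.
move=> mf fr; apply: modular_eq0 => //; apply/eqP.
rewrite eq_le modular_ge0 andbT; apply/lee_addgt0Pr => e e0; rewrite add0e.
have [e1|/ltW e1] := leP e 1; last first.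
  have [_] := fr 1 ltr01; rewrite (_ : (fun t => f t / 1) = f).
    by move=> h; apply: le_trans h _; rewrite lee_fin.
  by apply/funext => t; rewrite divr1.
have [_ h] := fr e e0.
have := modularZ (mdiv e mf) (ltW e0) e1.
rewrite (_ : (fun t => e * (f t / e)) = f); last first.
  by apply/funext => t; rewrite mulrC divfK// gt_eqF.
move=> k; apply: le_trans k _; rewrite -[leRHS]mule1.
by apply: lee_pmul => //; rewrite ?modular_ge0// lee_fin ltW.
Qed.

End modular.

Section Lvar.
Context {d : measure_display} {T : measurableType d} {R : realType}.
Variables (mu : {measure set T -> \bar R}) (p : exponent T R).

(* L^{p(.)}(mu), as a subset of L0 mu. *)
Definition Lvar_pred : {pred L0 mu} :=
  mem [set x : L0 mu | exists2 r : R, 0 < r &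
    (modular mu p (fun t => (x t / r)%R) < +oo)%E].

Local Notation radii := (luxemburg_radii mu p).
Local Notation lnorm := (luxemburg_norm mu p).

Lemma Lvar_predP (x : L0 mu) : reflect (radii x !=set0) (x \in Lvar_pred).
Proof.
apply: (iffP idP) => [/set_mem[r r0 xr]|[r [r0 xr]]].
  by apply: luxemburg_radii_nonempty xr => //; exact: measurable_L0.
by apply/mem_set; exists r => //; apply: le_lt_trans xr _; rewrite ltry.
Qed.

Let radii_ae (x : L0 mu) (f : T -> R) r : measurable_fun setT f ->
  {ae mu, forall t, x t = f t} -> radii f r -> radii x r.
Proof.
move=> mf xf; apply: luxemburg_radii_le => //; first exact: measurable_L0.
by apply: filterS xf => t ->.
Qed.

Lemma Lvar_solid (x y : L0 mu) : {ae mu, forall t, `|x t| <= `|y t|} ->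
  y \in Lvar_pred -> x \in Lvar_pred.
Proof.
move=> xy /Lvar_predP[r yr]; apply/Lvar_predP; exists r.
by apply: luxemburg_radii_le yr => //; exact: measurable_L0.
Qed.

Let Lvar_pred0 : 0 \in Lvar_pred.
Proof.
apply/Lvar_predP; exists 1; apply: (@radii_ae _ (fun=> 0)) => //.
  exact: L0_zeroE.
split => //; rewrite (_ : (fun=> _) = (fun=> 0)) ?modular0 ?lee_fin//.
by apply/funext => t; rewrite mul0r.
Qed.

Let Lvar_predD : {in Lvar_pred &, forall x y, x + y \in Lvar_pred}.
Proof.
move=> x y /Lvar_predP[r xr] /Lvar_predP[s ys]; apply/Lvar_predP.
exists (r + s); apply: (@radii_ae _ (fun t => x t + y t)).
- by apply: measurable_funD; exact: measurable_L0.
- exact: L0_addE.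
- by apply: luxemburg_radiiD => //; exact: measurable_L0.
Qed.

Let Lvar_predZ (a : R) : {in Lvar_pred, forall x, a *: x \in Lvar_pred}.
Proof.
move=> x; have [->|a0] := eqVneq a 0; first by rewrite scale0r => _; exact: Lvar_pred0.
move=> /Lvar_predP[r xr]; apply/Lvar_predP.
exists (`|a| * r); apply: (@radii_ae _ (fun t => a * x t)).
- by apply: measurable_funM => //; exact: measurable_L0.
- exact: L0_scaleE.
- exact: luxemburg_radiiZ.
Qed.

Let Lvar_submod_closed : submod_closed Lvar_pred.
Proof.
split; first exact: Lvar_pred0.
by move=> a x y xP yP; apply: Lvar_predD yP; exact: Lvar_predZ.
Qed.

HB.instance Definition _ := GRing.isSubmodClosed.Build _ _ Lvar_pred
  Lvar_submod_closed.

(* L^{p(.)}(mu), as a Banach lattice under the Luxemburg norm. *)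
Record Lvar : Type := MkLvar { Lvar_val : L0 mu ; _ : Lvar_val \in Lvar_pred }.
HB.instance Definition _ := [isSub for Lvar_val].
HB.instance Definition _ := [Choice of Lvar by <:].
HB.instance Definition _ := [SubChoice_isSubLmodule of Lvar by <:].

Lemma Lvar_radii (x : Lvar) : radii (Lvar_val x) !=set0.
Proof. exact/Lvar_predP/(valP x). Qed.

Definition Lvar_norm (x : Lvar) : R := lnorm (Lvar_val x).

Lemma Lvar_norm_lt (x : Lvar) r : Lvar_norm x < r -> radii (Lvar_val x) r.
Proof.
apply: luxemburg_norm_lt; [exact: measurable_L0|exact: Lvar_radii].
Qed.

Let Lvar_normD (x y : Lvar) : Lvar_norm (x + y) <= Lvar_norm x + Lvar_norm y.
Proof.
apply/ler_addgt0Pr => e e0; have e2 : 0 < e / 2 by rewrite divr_gt0.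
rewrite (splitr e) addrACA; apply: luxemburg_norm_le.
apply: (@radii_ae _ (fun t => Lvar_val x t + Lvar_val y t)).
- by apply: measurable_funD; exact: measurable_L0.
- exact: L0_addE.
- apply: luxemburg_radiiD; try exact: measurable_L0;
  by apply: Lvar_norm_lt; rewrite ltrDl.
Qed.

Let Lvar_norm_ge0 (x : Lvar) : 0 <= Lvar_norm x.
Proof. exact: luxemburg_norm_ge0. Qed.

Let Lvar_norm0 : Lvar_norm 0 = 0.
Proof.
apply/eqP; rewrite eq_le Lvar_norm_ge0 andbT.
apply/ler_addgt0Pr => e e0; rewrite add0r; apply: luxemburg_norm_le.
apply: (@radii_ae _ (fun=> 0)) => //; first exact: L0_zeroE.
split => //; rewrite (_ : (fun=> _) = (fun=> 0)) ?modular0 ?lee_fin//.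
by apply/funext => t; rewrite mul0r.
Qed.

Let Lvar_norm_leZ (a : R) (x : Lvar) : Lvar_norm (a *: x) <= `|a| * Lvar_norm x.
Proof.
have [->|a0] := eqVneq a 0; first by rewrite scale0r Lvar_norm0 normr0 mul0r.
have na0 : 0 < `|a| by rewrite normr_gt0.
rewrite -ler_pdivrMl//; apply/ler_addgt0Pr => e e0.
rewrite ler_pdivrMl//; apply: luxemburg_norm_le.
apply: (@radii_ae _ (fun t => a * Lvar_val x t)).
- by apply: measurable_funM => //; exact: measurable_L0.
- exact: L0_scaleE.
- by apply: luxemburg_radiiZ => //; apply: Lvar_norm_lt; rewrite ltrDl.
Qed.

Let Lvar_normZ (a : R) (x : Lvar) : Lvar_norm (a *: x) = `|a| * Lvar_norm x.
Proof.
apply/eqP; rewrite eq_le Lvar_norm_leZ/=.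
have [->|a0] := eqVneq a 0; first by rewrite normr0 mul0r.
have := Lvar_norm_leZ a^-1 (a *: x).
by rewrite scalerA mulVf// scale1r normfV ler_pdivlMl// normr_gt0.
Qed.

Let Lvar_norm_eq0 (x : Lvar) : Lvar_norm x = 0 -> x = 0.
Proof.
move=> x0; apply/val_inj/L0_eqP => /=.
have : {ae mu, forall t, Lvar_val x t = 0}.
  apply: (@luxemburg_radii_eq0 _ _ _ mu p); first exact: measurable_L0.
  by move=> r r0; apply: Lvar_norm_lt; rewrite x0.
move=> h; apply: filter_app h; apply: filter_app (L0_zeroE mu).
by apply: aeW => t /= h1 h2; rewrite h2 -h1.
Qed.

HB.instance Definition _ := @Lmodule_isNormed.Build R Lvar Lvar_norm
  Lvar_normD Lvar_normZ Lvar_norm_eq0.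

Lemma Lvar_normE (x : Lvar) : `|x| = luxemburg_norm mu p (Lvar_val x).
Proof. by []. Qed.


Section complete.
Variable x_ : nat -> Lvar.
Hypothesis x_cauchy : forall k m : nat,
  `|x_ k - x_ m| < 2 ^- k + 2 ^- m.

Let u (k : nat) : T -> R := Lvar_val (x_ k).

Let mu_ k : measurable_fun setT (u k).
Proof. exact: measurable_L0. Qed.

Let subE (x y : Lvar) :
  {ae mu, forall t, Lvar_val (x - y) t = Lvar_val x t - Lvar_val y t}.
Proof.
apply: filter_app (L0_addE (Lvar_val x) (- Lvar_val y)).
by apply: filter_app (L0_oppE (Lvar_val y)); apply: aeW => t /= <- <-.
Qed.

Let u_radii k m : radii (fun t => u m t - u k t) (2 ^- k + 2 ^- m).
Proof.
have /Lvar_norm_lt h := x_cauchy k m.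
apply: luxemburg_radii_le h => //.
- exact: measurable_funB.
- exact: measurable_L0.
- by apply: filterS (subE (x_ k) (x_ m)) => t ->; rewrite distrC.
Qed.

Let g (n : nat) : T -> R := fun t => \sum_(k < n) `|u k.+1 t - u k t|.

Let mg n : measurable_fun setT (g n).
Proof.
apply: measurable_sum => k; apply: measurableT_comp => //.
exact: measurable_funB.
Qed.

Let g_radii n : radii (g n) (4 - 3 * 2 ^- n).
Proof.
elim: n => [|n IH].
  rewrite /g expr0 invr1 mulr1; split; first by lra.
  rewrite (_ : (fun t => _) = (fun=> 0)) ?modular0 ?lee_fin//.
  by apply/funext => t; rewrite big_ord0 mul0r.
have -> : g n.+1 = (fun t => g n t + `|u n.+1 t - u n t|).
  by apply/funext => t; rewrite /g big_ord_recr.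
have mn : measurable_fun setT (fun t => `|u n.+1 t - u n t|).
  by apply: measurableT_comp => //; exact: measurable_funB.
have rn : radii (fun t => `|u n.+1 t - u n t|) (2 ^- n + 2 ^- n.+1).
  apply: luxemburg_radii_le (u_radii n n.+1) => //.
    exact: measurable_funB.
  by apply: aeW => t; rewrite normr_id.
have -> : 4 - 3 * 2 ^- n.+1 = (4 - 3 * 2 ^- n) + (2 ^- n + 2 ^- n.+1) :> R.
  rewrite exprS invfM; lra.
exact: luxemburg_radiiD.
Qed.

Let g4_radii n : radii (g n) 4.
Proof.
apply: luxemburg_radii_le (g_radii n) => //; first exact: aeW.
by rewrite lerBlDr lerDl mulr_ge0// invr_ge0 exprn_ge0.
Qed.

Let h (n : nat) (t : T) : \bar R := (`|g n t / 4| `^ p t)%:E.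

Let g_ge0 n t : 0 <= g n t.
Proof. by apply: sumr_ge0. Qed.

Let g_nd t : {homo g^~ t : n m / (n <= m)%N >-> n <= m}.
Proof.
apply/nondecreasing_seqP => n; rewrite /g big_ord_recr/=.
by rewrite lerDl.
Qed.

Let h_nd t : {homo h^~ t : n m / (n <= m)%N >-> (n <= m)%E}.
Proof.
move=> n m nm; rewrite /h lee_fin; apply: ge0_ler_powR; rewrite ?nnegrE//.
  exact: le_trans (exponent_ge1 p t).
rewrite !normrM ler_wpM2r// !ger0_norm//; exact: g_nd.
Qed.

Let g_bounded : {ae mu, forall t, has_ubound (range (g^~ t))}.
Proof.
have mh n : measurable_fun setT (h n).
  apply/measurable_EFinP/(measurable_normr_powR p (f := fun t => g n t / 4)).
  exact: measurable_funM.
have h0 n t : (0 <= h n t)%E by rewrite lee_fin powR_ge0.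
have H1 : (\int[mu]_t limn (h^~ t) <= 1)%E.
  rewrite monotone_convergence//.
  apply: lime_le.
    apply: ereal_nondecreasing_is_cvgn => n m nm.
    apply: ge0_le_integral => // t _; exact: h_nd.
  by apply: nearW => n; have [_] := g4_radii n; rewrite unlock.
have hH n t : (h n t <= limn (h^~ t))%E.
  have /cvg_lim -> // := ereal_nondecreasing_cvgn (@h_nd t).
  by apply: ereal_sup_ubound; exists n.
have iH : mu.-integrable setT (fun t => limn (h^~ t)).
  apply/integrableP; split.
    apply: (emeasurable_fun_cvg h) => // t _.
    exact/ereal_nondecreasing_is_cvgn/h_nd.
  apply: le_lt_trans (ltry 1); apply: le_trans H1; rewrite le_eqVlt.
  apply/orP; left; apply/eqP; apply: eq_integral => t _.
  by rewrite gee0_abs// (le_trans (h0 0%N t)).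
apply: filterS (integrable_ae measurableT iH) => t /(_ I) Hfin.
exists (4 * (1 + fine (limn (h^~ t)))) => _ [n _ <-].
have := hH n t; rewrite -[leRHS]fineK// lee_fin => hn.
have [g4|g4] := leP (g n t) 4.
  apply: (le_trans g4); rewrite ler_pMr// lerDl.
  by apply: le_trans hn; exact: powR_ge0.
have gn : g n t / 4 <= `|g n t / 4| `^ p t.
  rewrite ger0_norm ?divr_ge0//; apply: le1r_powR; last exact: exponent_ge1.
  by rewrite ler_pdivlMr// mul1r ltW.
have := le_trans gn hn; rewrite ler_pdivrMr// => k.
by apply: (le_trans k); rewrite mulrC ler_pM2l// lerDr.
Qed.

Let u_cvg : {ae mu, forall t, cvgn (u^~ t)}.
Proof.
apply: filterS g_bounded => t gb.
have : cvgn (series (telescope (u^~ t))).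
  apply: normed_cvg.
  have -> : [normed series (telescope (u^~ t))] = g^~ t.
    by apply/funext => n; rewrite /normed_series_of/= /series/= big_mkord.
  apply: nondecreasing_is_cvgn => //; exact: g_nd.
rewrite telescopeK => c; apply/cvg_ex.
move/cvg_ex : c => [l /= cl]; exists (l + u 0%N t).
rewrite (_ : u^~ t = [sequence u n t - u 0%N t]_n \+ cst (u 0%N t)).
  by apply: cvgD cl _; exact: cvg_cst.
by apply/funext => n /=; rewrite subrK.
Qed.

Let f (t : T) : R := fine (limn_esup (fun k => (u k t)%:E)).

Let mf : measurable_fun setT f.
Proof.
apply: measurableT_comp; first exact: fine_measurable.
by apply: measurable_fun_limn_esup => n; apply/measurable_EFinP.
Qed.

Let u_cvg_f : {ae mu, forall t, u k t @[k --> \oo] --> f t}.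
Proof.
apply: filterS u_cvg => t /cvg_ex[l ul].
have : (u k t)%:E @[k --> \oo] --> l%:E by apply: cvg_EFin => //; exact: nearW.
by move=> /cvg_limn_einf_sup[_]; rewrite /f => ->.
Qed.

Let einf_ge (a q : R) (v : nat -> R) : 1 <= q -> 0 <= a ->
  (forall n, 0 <= v n) -> v n @[n --> \oo] --> a ->
  ((a `^ q)%:E <= limn_einf (fun n => (v n `^ q)%:E))%E.
Proof.
move=> q1 a0 v0 va; have q0 : q != 0 by rewrite gt_eqF// (lt_le_trans ltr01).
move: a0; rewrite le_eqVlt => /predU1P[a0|a0].
  rewrite -a0 powR0// limn_einf_lim; apply: lime_ge; first exact: is_cvg_einfs.
  apply: nearW => n; apply: le_ereal_inf_tmp => _ [m _ <-].
  by rewrite lee_fin powR_ge0.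
have c : {for a, continuous ((@powR R)^~ q)}.
  apply: differentiable_continuous; apply/derivable1_diffP.
  by have [] := is_derive1_powR q a0.
have h1 : v n `^ q @[n --> \oo] --> a `^ q by exact: (cvg_comp _ _ va c).
have : (v n `^ q)%:E @[n --> \oo] --> (a `^ q)%:E.
  by apply: cvg_EFin => //; exact: nearW.
by move=> /cvg_limn_einf_sup[-> _].
Qed.

Let f_radii k : radii (fun t => f t - u k t) (2 * 2 ^- k).
Proof.
have s0 : 0 < 2 * 2 ^- k :> R by rewrite mulr_gt0// invr_gt0 exprn_gt0.
split => //; set s := 2 * 2 ^- k; rewrite unlock.
pose w (n : nat) (t : T) : \bar R := (`|(u (k + n) t - u k t) / s| `^ p t)%:E.
have mw n : measurable_fun setT (w n).
  apply/measurable_EFinP/(measurable_normr_powR p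
    (f := fun t => (u (k + n) t - u k t) / s)).
  by apply: measurable_funM => //; exact: measurable_funB.
have w0 n t : (0 <= w n t)%E by rewrite lee_fin powR_ge0.
have mlim : measurable_fun setT (fun t => limn_einf (w^~ t)).
  rewrite /limn_einf; apply: measurableT_comp => //.
  by apply: measurable_fun_limn_esup => n; exact: measurableT_comp.
have lim0 t : (0 <= limn_einf (w^~ t))%E.
  rewrite limn_einf_lim; apply: lime_ge; first exact: is_cvg_einfs.
  by apply: nearW => n; apply: le_ereal_inf_tmp => _ [m _ <-].
apply: (@le_trans _ _ (\int[mu]_t limn_einf (w^~ t))%E).
  apply: ae_ge0_le_integral => //.
    apply/measurable_EFinP/(measurable_normr_powR p
      (f := fun t => (f t - u k t) / s)).
    by apply: measurable_funM => //; exact: measurable_funB.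
  apply: filterS u_cvg_f => t uf _; apply: einf_ge => //.
    exact: exponent_ge1.
  have uf' : u (k + n) t @[n --> \oo] --> f t.
    by move: uf; rewrite -(cvg_shiftn k); under eq_fun do rewrite addnC.
  by apply: cvg_norm; apply: cvgMl; apply: cvgB => //; exact: cvg_cst.
apply: (@le_trans _ _ _ _ _ (fatou mu measurableT mw (fun n t _ => w0 n t))).
rewrite limn_einf_lim; apply: lime_le; first exact: is_cvg_einfs.
apply: nearW => n; apply: (@le_trans _ _ (\int[mu]_t w n t)%E).
  by apply: ereal_inf_lbound; exists n => /=.
suff [_] : radii (fun t => u (k + n) t - u k t) s by rewrite unlock.
apply: luxemburg_radii_le (u_radii k (k + n)); try exact: measurable_funB.
  exact: aeW.
rewrite /s mulrDl mul1r lerD2l lef_pV2 ?posrE ?exprn_gt0//.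
by rewrite ler_weXn2l ?leq_addr// ler1n.
Qed.

Lemma Lvar_complete_seq : exists x : Lvar, forall k, `|x_ k - x| <= 2 * 2 ^- k.
Proof.
have fP : L0_mk mu mf \in Lvar_pred.
  apply/Lvar_predP; have [r ur] := Lvar_radii (x_ 0%N).
  exists (2 * 2 ^- 0 + r).
  apply: (@radii_ae _ f) => //; first exact: L0_mkE.
  have := luxemburg_radiiD (measurable_funB mf (mu_ 0%N)) (mu_ 0%N)
    (f_radii 0%N) ur.
  rewrite (_ : (fun t => (f \- u 0%N) t + u 0%N t) = f)//.
  by apply/funext => t /=; rewrite subrK.
exists (MkLvar fP) => k; apply: luxemburg_norm_le.
apply: luxemburg_radii_le (f_radii k) => //.
- exact: measurable_L0.
- exact: measurable_funB.
- apply: filter_app (subE (x_ k) (MkLvar fP)).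
  apply: filter_app (L0_mkE mu mf); apply: aeW => t /= fE ->.
  by rewrite fE distrC.
Qed.

End complete.

Let Lvar_cauchy_cvg (F : set_system Lvar) : ProperFilter F -> cauchy F -> cvg F.
Proof.
move=> FF /cauchyP Fc.
have e0 k : 0 < 2 ^- k :> R by rewrite invr_gt0 exprn_gt0.
have [x_ x_F] := choice (fun k => Fc (2 ^- k) (e0 k)).
have x_c k m : `|x_ k - x_ m| < 2 ^- k + 2 ^- m.
  have [y [yk ym]] := filter_ex (filterI (x_F k) (x_F m)).
  move: yk ym; rewrite -ball_normE /= => yk ym.
  apply: le_lt_trans (ler_distD y _ _) _.
  by apply: ltrD yk _; rewrite distrC.
have [x xk] := Lvar_complete_seq x_c.
apply/cvg_ex; exists x; apply/cvgrPdist_lt => e e_gt0.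
have [k ke] : exists k, 3 * 2 ^- k < e :> R.
  have e3 : 0 <= 3 / e by rewrite divr_ge0// ltW.
  exists (Num.bound (3 / e)); rewrite ltr_pdivrMr ?exprn_gt0//.
  rewrite mulrC -ltr_pdivrMr//; apply: (lt_trans (archi_boundP e3)).
  by rewrite -natrX ltr_nat ltn_expl.
apply: filterS (x_F k) => y; rewrite -ball_normE /= => yk.
apply: le_lt_trans (ler_distD (x_ k) _ _) _; apply: le_lt_trans ke.
rewrite (_ : 3 * 2 ^- k = 2 * 2 ^- k + 2 ^- k); last lra.
by apply: lerD (ltW yk); rewrite distrC.
Qed.


HB.instance Definition _ := Uniform_isComplete.Build Lvar Lvar_cauchy_cvg.

Let Lvar_pred_bound (x y z : L0 mu) :
  {ae mu, forall t, `|z t| <= `|x t| + `|y t|} ->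
  x \in Lvar_pred -> y \in Lvar_pred -> z \in Lvar_pred.
Proof.
move=> zxy xP yP; pose a (w : L0 mu) := L0_join w (- w).
have aP (w : L0 mu) : w \in Lvar_pred -> a w \in Lvar_pred.
  by apply: Lvar_solid; apply: filterS (L0_absE w) => t ->; rewrite normr_id.
apply: (Lvar_solid _ (Lvar_predD (aP x xP) (aP y yP))).
apply: filter_app zxy; apply: filter_app (L0_addE (a x) (a y)).
apply: filter_app (L0_absE x); apply: filter_app (L0_absE y).
apply: aeW => t /= ay ax -> h; rewrite ax ay.
by rewrite [leRHS]ger0_norm// addr_ge0.
Qed.

Let Lvar_meet_proof (x y : Lvar) :
  L0_meet (Lvar_val x) (Lvar_val y) \in Lvar_pred.
Proof.
apply: (Lvar_pred_bound _ (valP x) (valP y)).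
apply: filterS (L0_meetE (Lvar_val x) (Lvar_val y)) => t ->.
by have [_|_] := leP (Lvar_val x t) (Lvar_val y t); rewrite ?lerDl ?lerDr.
Qed.

Let Lvar_join_proof (x y : Lvar) :
  L0_join (Lvar_val x) (Lvar_val y) \in Lvar_pred.
Proof.
apply: (Lvar_pred_bound _ (valP x) (valP y)).
apply: filterS (L0_joinE (Lvar_val x) (Lvar_val y)) => t ->.
by have [_|_] := leP (Lvar_val x t) (Lvar_val y t); rewrite ?lerDl ?lerDr.
Qed.

Definition Lvar_le (x y : Lvar) : Prop := L0_le (Lvar_val x) (Lvar_val y).
Definition Lvar_meet (x y : Lvar) : Lvar := MkLvar (Lvar_meet_proof x y).
Definition Lvar_join (x y : Lvar) : Lvar := MkLvar (Lvar_join_proof x y).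

Let Lvar_le_anti (x y : Lvar) : Lvar_le x y -> Lvar_le y x -> x = y.
Proof. by move=> xy yx; apply/val_inj; exact: L0_le_anti. Qed.

Let Lvar_norm_le (x y : Lvar) :
  Lvar_le (Lvar_join x (- x)) (Lvar_join y (- y)) -> `|x| <= `|y|.
Proof.
move=> xy; apply/ler_addgt0Pr => e e0; apply: luxemburg_norm_le.
have yr : radii (Lvar_val y) (`|y| + e) by apply: Lvar_norm_lt; rewrite ltrDl.
apply: luxemburg_radii_le yr => //; try exact: measurable_L0.
apply: filter_app xy; apply: filter_app (L0_absE (Lvar_val x)).
by apply: filter_app (L0_absE (Lvar_val y)); apply: aeW => t /= -> ->.
Qed.

HB.instance Definition _ := @isBanachLattice.Build R Lvar
  Lvar_le Lvar_meet Lvar_join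
  (fun x => L0_le_refl (Lvar_val x)) Lvar_le_anti
  (fun y x z => @L0_le_trans _ _ _ _ (Lvar_val y) (Lvar_val x) (Lvar_val z))
  (fun x y z => L0_meetP (Lvar_val x) (Lvar_val y) (Lvar_val z))
  (fun x y z => L0_joinP (Lvar_val x) (Lvar_val y) (Lvar_val z))
  (fun x y z => @L0_leD _ _ _ _ (Lvar_val x) (Lvar_val y) (Lvar_val z))
  (fun a x => @L0_leZ _ _ _ _ a (Lvar_val x))
  Lvar_norm_le.

End Lvar.

Arguments Lvar_pred {d T R} mu p.

Section inclusion.
Context {d : measure_display} {T : measurableType d} {R : realType}.
Variables (mu : {measure set T -> \bar R}) (p q : exponent T R).
Variable pq : {subset Lvar_pred mu p <= Lvar_pred mu q}.

Definition Lvar_incl (x : Lvar mu p) : Lvar mu q := MkLvar (pq (valP x)).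

Let Lvar_incl_linear : linear Lvar_incl.
Proof. by move=> a x y; apply/val_inj. Qed.

HB.instance Definition _ := GRing.isLinear.Build R (Lvar mu p) (Lvar mu q) _
  Lvar_incl Lvar_incl_linear.

End inclusion.

Definition non_atomic {d : measure_display} {T : measurableType d}
    {R : realType} (mu : {measure set T -> \bar R}) : Prop :=
  forall A : set T, measurable A -> (0 < mu A)%E ->
    exists B : set T,
      [/\ measurable B, B `<=` A, (0 < mu B)%E & (mu B < mu A)%E].

(* Main.v *)
Require Import Defs.
From mathcomp Require Import all_boot all_order all_algebra.
From mathcomp Require Import all_classical all_reals all_analysis.
From mathcomp Require Import measurable_realfun lra.

Set Implicit Arguments.
Unset Strict Implicit.
Unset Printing Implicit Defensive.

Import Order.TTheory GRing.Theory Num.Theory numFieldNormedType.Exports.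
Local Open Scope classical_set_scope.
Local Open Scope ring_scope.

(** The inclusion fixes copies of a sequence space spanned by indicators of
disjoint sets of measure at least 1.

An inclusion can only lower the exponent: q <= p almost everywhere
([Lvar_incl_exponent_le]). Otherwise p <= u < v <= q on a set of positive
measure for some rationals u, v. Non-atomicity provides subsets B of it of
arbitrarily small positive measure m, and the multiple a = m^(-1/u) of the
indicator of B has norm at most 1 in L^p, whereas a bounded inclusion would
force a^v m = a^(v - u) to stay bounded.

A non-atomic measure, in the sense used here, is semifinite, so an infinite one
has a disjoint sequence F of measurable sets with 1 <= mu (F n) < +oo
([non_atomic_disjoint_large]). Let g be a combination of the indicators of the
F n whose modular in L^q is at most 1. Each coefficient b of g satisfies
|b| <= 1, for |b| > 1 would make the modular at least |b| mu (F n) > 1.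
Hence |g| <= 1, so that |g|^p <= |g|^q almost everywhere and the modular of g in
L^p is at most 1 too. By homogeneity the norm of g in L^p is at most its norm in
L^q ([Lvar_step_norm_le]); together with the continuity of the inclusion, this
makes the inclusion an isomorphism on the closed span of the normalized
indicators ([isomorphism_on_bounded_below]). *)

(** * Operators bounded below on a span *)

Section bounded_below.
Context {R : realType} {E : banachLatticeType R} {F : completeNormedModType R}.
Variables (T : {linear E -> F}) (f : nat -> E).

Let lin_span : set E :=
  [set x | exists n (a : nat -> R), x = \sum_(i < n) a i *: f i].

Lemma lin_spanB (x y : E) : lin_span x -> lin_span y -> lin_span (x - y).
Proof.
move=> [n [a ->]] [m [b ->]].
pose cut (k : nat) (c : nat -> R) i := if (i < k)%N then c i else 0.
have cutE k (c : nat -> R) : (k <= n + m)%N ->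
    \sum_(i < k) c i *: f i = \sum_(i < n + m) cut k c i *: f i.
  move=> km; rewrite (big_ord_widen _ (fun i => c i *: f i) km) big_mkcond/=.
  by apply: eq_bigr => i _; rewrite /cut; case: ifP => // _; rewrite scale0r.
exists (n + m)%N, (fun i => cut n a i - cut m b i).
rewrite (cutE n) ?leq_addr// (cutE m) ?leq_addl// -sumrB.
by apply: eq_bigr => i _; rewrite scalerBl.
Qed.

(** The lower bound passes to the closed span by density. Since the span is
stable under differences, it says that the inverse of T is C-Lipschitz there. *)
Lemma isomorphism_on_bounded_below (C : R) : 0 < C -> continuous T ->
  (forall n (a : nat -> R), `|\sum_(i < n) a i *: f i|
    <= C * `|T (\sum_(i < n) a i *: f i)|) ->
  isomorphism_on T (closed_span f).
Proof.
move=> C0 cT TC.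
have closeB (x y : E) : closed_span f x -> closed_span f y ->
    `|x - y| <= C * `|T x - T y|.
  move=> fx fy; apply/ler_addgt0Pr => e e0.
  (* Replacing x and y by r-approximations costs 2r on the left-hand side and
     2rC on the right-hand side. *)
  pose r := e / (2 * (1 + C)).
  have r0 : 0 < r by rewrite divr_gt0// mulr_gt0// addr_gt0.
  have er : e = r * (2 * (1 + C)).
    by rewrite divfK// gt_eqF// mulr_gt0// addr_gt0.
  have near_span z : closed_span f z -> exists w, [/\ lin_span w,
      `|z - w| < r & `|T z - T w| < r].
    move=> /(_ [set w | `|z - w| < r /\ `|T z - T w| < r]) [].
      apply: filterI; last by move/cvgrPdist_lt : (cT z) => /(_ _ r0).
      by have /cvgrPdist_lt/(_ _ r0) : nbhs z --> z by exact: cvg_id.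
    by move=> w [sw [h1 h2]]; exists w.
  have [x' [sx x1 x2]] := near_span x fx.
  have [y' [sy y1 y2]] := near_span y fy.
  have xy' : `|x' - y'| <= C * `|T x' - T y'|.
    by have [n [a ea]] := lin_spanB sx sy; rewrite -linearB ea.
  have Txy : `|T x' - T y'| <= `|T x - T y| + 2 * r.
    have := ler_distD (T x) (T x') (T y'); have := ler_distD (T y) (T x) (T y').
    rewrite (distrC (T x') (T x)); lra.
  have := ler_wpM2l (ltW C0) Txy.
  have := ler_distD x' x y; have := ler_distD y' x' y.
  rewrite (distrC y' y); lra.
have inj x y : closed_span f x -> closed_span f y -> T x = T y -> x = y.
  move=> fx fy Txy; apply/eqP; rewrite -subr_eq0 -normr_le0.
  by apply: (le_trans (closeB _ _ fx fy)); rewrite Txy subrr normr0 mulr0.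
split; first exact: continuous_subspaceT.
pose S y := xget 0 [set x | closed_span f x /\ T x = y].
have SK x : closed_span f x -> S (T x) = x.
  move=> fx; rewrite /S; case: xgetP => [z -> [fz /inj]|/(_ x)[]//]; exact.
exists S => //; apply/subspace_continuousP => _ [x fx <-].
rewrite /from_subspace SK//; apply/cvgrPdist_lt => e e0.
have eC : 0 < e / C by rewrite divr_gt0.
have /cvgrPdist_lt/(_ _ eC) : nbhs (T x) --> T x by exact: cvg_id.
apply: filterS => _ /= /[swap] [[y fy <-]] xy.
rewrite SK//; apply: (le_lt_trans (closeB _ _ fx fy)).
by rewrite mulrC -ltr_pdivlMr.
Qed.
End bounded_below.

(** * Sets of prescribed size for a non-atomic measure *)

Section nonatomic.
Context {d : measure_display} {T : measurableType d} {R : realType}.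
Variable mu : {measure set T -> \bar R}.
Hypothesis mu_na : non_atomic mu.

(** This is semifiniteness: the strict inequality in the definition of
non-atomicity rules out sets all of whose measurable subsets have measure 0
or +oo. *)
Lemma non_atomic_finite (A : set T) : measurable A -> (0 < mu A)%E ->
  exists B, [/\ measurable B, B `<=` A, (0 < mu B)%E & (mu B < +oo)%E].
Proof.
move=> mA A0; have [B [mB BA B0 BltA]] := mu_na mA A0.
by exists B; split => //; apply: (lt_le_trans BltA); exact: leey.
Qed.

(** Splitting a set of finite measure in two leaves a piece with at most half of
its measure; this is iterated. *)
Lemma non_atomic_small (A : set T) (e : R) : measurable A -> (0 < mu A)%E ->
  0 < e ->
  exists B, [/\ measurable B, B `<=` A, (0 < mu B)%E & (mu B <= e%:E)%E].
Proof.
move=> mA A0 e0.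
have [B [mB BA B0 Boo]] := non_atomic_finite mA A0.
have halve n : exists D, [/\ measurable D, D `<=` B, (0 < mu D)%E &
    ((2 ^+ n)%R%:E * mu D <= mu B)%E].
  elim: n => [|n [D [mD DB D0 Dn]]]; first by exists B; split;
    rewrite ?expr0 ?mul1e.
  have [D1 [mD1 D1D D10 D1ltD]] := mu_na mD D0.
  have Doo : (mu D < +oo)%E.
    by apply: le_lt_trans Boo; apply: le_measure; rewrite ?inE.
  have D1oo : (mu D1 < +oo)%E by exact: lt_trans Doo.
  have mD2 : measurable (D `\` D1) by exact: measurableD.
  have DE : mu D = (mu D1 + mu (D `\` D1))%E.
    rewrite -measureU//; last by rewrite setDIK.
    by rewrite setDUK.
  have D2oo : (mu (D `\` D1) < +oo)%E.
    apply: le_lt_trans Doo; apply: le_measure; rewrite ?inE//.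
  have D20 : (0 < mu (D `\` D1))%E.
    move: D1ltD; rewrite DE; rewrite -{1}[mu D1]adde0 lteD2lE//.
    by rewrite ge0_fin_numE.
  move: Dn; rewrite DE.
  have [le12|/ltW le21] := leP (mu D1) (mu (D `\` D1)) => Dn.
    exists D1; split => //; first exact: subset_trans DB.
    apply: le_trans Dn; rewrite exprSr EFinM -muleA lee_wpmul2l//.
    by rewrite mule_natl mule2n leeD2l.
  exists (D `\` D1); split => //; first exact: subset_trans DB.
  apply: le_trans Dn; rewrite exprSr EFinM -muleA lee_wpmul2l//.
  by rewrite mule_natl mule2n leeD2r.
have [r Br] : exists r : R, mu B = r%:E.
  by exists (fine (mu B)); rewrite fineK// ge0_fin_numE.
have r0 : 0 <= r / e by rewrite divr_ge0 ?(ltW e0)// -lee_fin -Br.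
have [D [mD DB D0 Dn]] := halve (Num.bound (r / e)).
exists D; split => //; first exact: subset_trans BA.
have n0 : 0 < 2 ^+ Num.bound (r / e) :> R by rewrite exprn_gt0.
rewrite -(@lee_pmul2l _ (2 ^+ Num.bound (r / e))%:E)//.
apply: (le_trans Dn); rewrite Br -EFinM lee_fin -ler_pdivrMr//.
by apply/ltW/(lt_trans (archi_boundP r0)); rewrite -natrX ltr_nat ltn_expl.
Qed.

(** Exhaustion: if all subsets of A of finite measure had measure less than 1, a
countable union of them would attain the supremum s of their measures; what
remains of A has infinite measure, hence contains a set of positive finite
measure whose addition exceeds s. *)
Lemma non_atomic_large (A : set T) : measurable A -> mu A = +oo%E ->
  exists B, [/\ measurable B, B `<=` A, (1 <= mu B)%E & (mu B < +oo)%E].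
Proof.
move=> mA Aoo; apply: contrapT => noB.
have small B : measurable B -> B `<=` A -> (mu B < +oo)%E -> (mu B < 1)%E.
  by move=> mB BA Boo; rewrite ltNge; apply/negP => B1; apply: noB; exists B.
pose fin := [set B | [/\ measurable B, B `<=` A & (mu B < +oo)%E]].
pose s := ereal_sup (mu @` fin).
have s1 : (s <= 1)%E.
  by apply: ge_ereal_sup => _ [B [mB BA Boo] <-]; exact/ltW/small.
have s0 : (0 <= s)%E.
  by apply: ereal_sup_ubound; exists set0; rewrite ?measure0//;
    split; rewrite ?measure0 ?ltry.
have sfin : s \is a fin_num by rewrite ge0_fin_numE// (le_lt_trans s1)// ltry.
have approx n : exists B, fin B /\ (s - (n.+1%:R^-1)%R%:E <= mu B)%E.
  have n0 : 0 < n.+1%:R^-1 :> R by rewrite invr_gt0.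
  by have [_ [B fB <-] /ltW] := ub_ereal_sup_adherent n0 sfin; exists B.
have [B Bs] := choice approx.
pose U n := \big[setU/set0]_(i < n) B i.
have finU n : fin (U n).
  rewrite /U; elim: n => [|n [mU UA Uoo]].
    by rewrite big_ord0; split; rewrite ?measure0//; exact: sub0set.
  have [[mB BA Boo] _] := Bs n.
  rewrite big_ord_recr/=; split; first exact: measurableU.
  - by rewrite subUset.
  - by rewrite (le_lt_trans (measureU2 _ _ _))// lte_add_pinfty.
have mUoo : measurable (\bigcup_n U n).
  by apply: bigcup_measurable => n _; have [] := finU n.
have Us : (mu (\bigcup_n U n) <= s)%E.
  have mU n : measurable (U n) by have [] := finU n.
  have ndU : {homo U : n m / (n <= m)%N >-> (n <= m)%O}.
    by move=> n m nm; apply/subsetPset; exact: subset_bigsetU.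
  have h := nondecreasing_cvg_mu (mu := mu) mU mUoo ndU.
  rewrite -(cvg_lim _ h)//; apply: lime_le.
    by apply/cvg_ex; eexists; exact: h.
  by apply: nearW => n; apply: ereal_sup_ubound; exists (U n).
have UA : \bigcup_n U n `<=` A.
  by apply: bigcup_sub => n _; have [] := finU n.
have Uoo : (mu (\bigcup_n U n) < +oo)%E.
  by apply: (le_lt_trans Us); rewrite -ge0_fin_numE.
have sU : (s <= mu (\bigcup_n U n))%E.
  apply/lee_addgt0Pr => e e0; rewrite -leeBlDr//.
  have [n ne] : exists n, n.+1%:R^-1 <= e.
    have e1 : 0 <= e^-1 by rewrite invr_ge0 ltW.
    exists (Num.bound e^-1); rewrite -[leRHS]invrK lef_pV2 ?posrE ?invr_gt0//.
    by apply/ltW/(lt_trans (archi_boundP e1)); rewrite ltr_nat.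
  have [[mB BA Boo] sB] := Bs n.
  apply: (@le_trans _ _ (mu (B n))).
    by apply: le_trans sB; rewrite leeB// lee_fin.
  apply: le_measure; rewrite ?inE// => t Bt; exists n.+1 => //.
  by rewrite /U big_ord_recr/=; right.
have DA0 : (0 < mu (A `\` \bigcup_n U n))%E.
  rewrite ltNge; apply/negP => D0; suff: (mu A < +oo)%E by rewrite Aoo.
  rewrite -(setDUK UA) (le_lt_trans (measureU2 _ _ _))//.
    exact: measurableD.
  by rewrite lte_add_pinfty// (le_lt_trans D0).
have [C [mC CD C0 Coo]] := non_atomic_finite (measurableD mA mUoo) DA0.
have : (mu (\bigcup_n U n `|` C) <= s)%E.
  apply: ereal_sup_ubound; exists (\bigcup_n U n `|` C) => //; split.
  - exact: measurableU.
  - by rewrite subUset; split => // t /CD[].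
  - by rewrite (le_lt_trans (measureU2 _ _ _))// lte_add_pinfty.
rewrite measureU//; last by apply/seteqP; split => // t [Ut /CD[]].
apply/negP; rewrite -ltNge; apply: (le_lt_trans sU).
by rewrite -[ltLHS]adde0 lteD2lE// ge0_fin_numE.
Qed.

(** The sets are chosen greedily: removing a set of finite measure leaves a set
of infinite measure to continue with. *)
Lemma non_atomic_disjoint_large (A : set T) : measurable A -> mu A = +oo%E ->
  exists F : nat -> set T, [/\ forall n, measurable (F n),
    forall n, F n `<=` A, trivIset setT F &
    forall n, (1 <= mu (F n))%E /\ (mu (F n) < +oo)%E].
Proof.
move=> mA Aoo.
pose good D B := [/\ measurable B, B `<=` D, (1 <= mu B)%E & (mu B < +oo)%E].
have ex D : exists B, measurable D -> mu D = +oo%E -> good D B.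
  have [[mD Doo]|nD] := pselect (measurable D /\ mu D = +oo%E).
    by have [B gB] := non_atomic_large mD Doo; exists B.
  by exists set0 => mD Doo; case: nD.
have [g gP] := choice ex.
(* D n is what remains of A after n choices, and g (D n) is the next choice. *)
pose D n := iter n (fun D => D `\` g D) A.
have DP n : measurable (D n) /\ mu (D n) = +oo%E.
  elim: n => [//|n [mD Doo]]; have [mg gD g1 goo] := gP _ mD Doo.
  split => /=; first exact: measurableD.
  apply/eqP; apply/contraT => h; suff: (mu (D n) < +oo)%E by rewrite Doo.
  have m1 : measurable (D n `\` g (D n)) by exact: measurableD.
  rewrite -(setDUK gD) (le_lt_trans (measureU2 _ _ _))//.
  by rewrite lte_add_pinfty// ltey.
have gDP n : good (D n) (g (D n)) by have [] := DP n; exact: gP.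
have Dnd n m : (n <= m)%N -> D m `<=` D n.
  elim: m => [|m IH]; first by rewrite leqn0 => /eqP ->.
  rewrite leq_eqVlt => /predU1P[->//|nm].
  exact: subset_trans (@subDsetl _ _ _) (IH nm).
exists (fun n => g (D n)); split => [n|n||n].
- by have [] := gDP n.
- by have [_ h _ _] := gDP n; apply: (subset_trans h); exact: (Dnd 0%N).
- apply: ltn_trivIset => n m nm; rewrite setIC.
  apply/disjoints_subset => t gt gt'.
  have [_ h _ _] := gDP n; have := Dnd _ _ nm _ (h _ gt).
  by case=> _; exact.
- by have [] := gDP n.
Qed.
End nonatomic.

(** * Luxemburg radii of multiples of indicators *)

Section indicator.
Context {d : measure_display} {T : measurableType d} {R : realType}.
Variables (mu : {measure set T -> \bar R}) (p : exponent T R).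

Lemma measurable_fun_scale_indic (a : R) (A : set T) : measurable A ->
  measurable_fun setT (fun t => a * \1_A t : R).
Proof. by move=> mA; apply: measurable_funM => //; exact: measurable_indic. Qed.

Lemma integral_scale_indic (a : R) (A : set T) : 0 <= a -> measurable A ->
  (\int[mu]_t (a * \1_A t)%:E = a%:E * mu A)%E.
Proof.
move=> a0 mA; under eq_integral do rewrite EFinM.
rewrite ge0_integralZl_EFin//; first by rewrite integral_indic// setIT.
by apply/measurable_EFinP; exact: measurable_indic.
Qed.

Lemma normr_indic_powR (a s : R) (A : set T) (t : T) : 1 <= s ->
  `|a * \1_A t| `^ s = `|a| `^ s * \1_A t.
Proof.
move=> s1; rewrite indicE; case: (t \in A); first by rewrite !mulr1.
by rewrite !mulr0 normr0 powR0// gt_eqF// (lt_le_trans ltr01).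
Qed.

(** The hypothesis 1 <= |a| makes the powers of |a| increase with the exponent,
so that a bound on p over A becomes a bound on the integrand. *)
Lemma modular_indic_le (a u : R) (A : set T) : measurable A -> 1 <= `|a| ->
  (forall t, A t -> p t <= u) ->
  (modular mu p (fun t => (a * \1_A t)%R) <= (`|a| `^ u)%:E * mu A)%E.
Proof.
move=> mA a1 pu; rewrite unlock -integral_scale_indic ?powR_ge0//.
apply: ge0_le_integral => //.
- apply/measurable_EFinP/(measurable_normr_powR p (f := fun t => a * \1_A t)).
  exact: measurable_fun_scale_indic.
- by apply/measurable_EFinP; exact: measurable_fun_scale_indic.
- move=> t _; rewrite lee_fin normr_indic_powR ?exponent_ge1// indicE.
  have [tA|_] := boolP (t \in A); last by rewrite !mulr0.
  by rewrite !mulr1 ler_powR//; apply: pu; exact: set_mem.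
Qed.

Lemma modular_indic_ge (a u : R) (A : set T) : measurable A -> 1 <= `|a| ->
  (forall t, A t -> u <= p t) ->
  ((`|a| `^ u)%:E * mu A <= modular mu p (fun t => (a * \1_A t)%R))%E.
Proof.
move=> mA a1 pu; rewrite unlock -integral_scale_indic ?powR_ge0//.
apply: ge0_le_integral => //.
- by apply/measurable_EFinP; exact: measurable_fun_scale_indic.
- apply/measurable_EFinP/(measurable_normr_powR p (f := fun t => a * \1_A t)).
  exact: measurable_fun_scale_indic.
- move=> t _; rewrite lee_fin normr_indic_powR ?exponent_ge1// indicE.
  have [tA|_] := boolP (t \in A); last by rewrite !mulr0.
  by rewrite !mulr1 ler_powR//; apply: pu; exact: set_mem.
Qed.

Lemma luxemburg_radii_indic_le (a u r : R) (A : set T) : measurable A ->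
  0 < r <= `|a| -> (forall t, A t -> p t <= u) ->
  ((`|a / r| `^ u)%:E * mu A <= 1)%E ->
  luxemburg_radii mu p (fun t => a * \1_A t) r.
Proof.
move=> mA /andP[r0 ra] pu a1; split => //; apply: le_trans a1.
rewrite (_ : (fun t => _) = (fun t => a / r * \1_A t)); last first.
  by apply/funext => t; rewrite mulrAC.
apply: modular_indic_le => //.
by rewrite normrM normfV (gtr0_norm r0) ler_pdivlMr// mul1r.
Qed.

Lemma luxemburg_radii_indic_ge (a u r : R) (A : set T) : measurable A ->
  r <= `|a| -> (forall t, A t -> u <= p t) ->
  luxemburg_radii mu p (fun t => a * \1_A t) r ->
  ((`|a / r| `^ u)%:E * mu A <= 1)%E.
Proof.
move=> mA ra pu [r0]; apply: le_trans.
rewrite (_ : (fun t => _) = (fun t => a / r * \1_A t)); last first.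
  by apply/funext => t; rewrite mulrAC.
apply: modular_indic_ge => //.
by rewrite normrM normfV (gtr0_norm r0) ler_pdivlMr// mul1r.
Qed.

Lemma L0_mk_Lvar (f : T -> R) (mf : measurable_fun setT f) (r : R) :
  luxemburg_radii mu p f r -> L0_mk mu mf \in Lvar_pred mu p.
Proof.
move=> fr; apply/Lvar_predP; exists r.
apply: luxemburg_radii_le fr => //; first exact: measurable_L0.
by apply: filterS (L0_mkE mu mf) => t ->.
Qed.

Lemma luxemburg_radii_ae (f g : T -> R) (r : R) : measurable_fun setT f ->
  measurable_fun setT g -> {ae mu, forall t, f t = g t} ->
  luxemburg_radii mu p g r -> luxemburg_radii mu p f r.
Proof.
move=> mf mg fg; apply: luxemburg_radii_le => //.
by apply: filterS fg => t ->.
Qed.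

(** For |b| > r the modular of f / r would be at least |b / r| mu A > 1, since
the exponent is at least 1. *)
Lemma cst_on_le_radius (f : T -> R) (b r : R) (A : set T) :
  measurable_fun setT f -> measurable A -> (1 <= mu A)%E ->
  (forall t, A t -> f t = b) -> luxemburg_radii mu p f r -> `|b| <= r.
Proof.
move=> mf mA A1 fb fr; have r0 : 0 < r by case: fr.
rewrite leNgt; apply/negP => rb.
have br : luxemburg_radii mu p (fun t => b * \1_A t) r.
  apply: luxemburg_radii_le fr => //; first exact: measurable_fun_scale_indic.
  apply: aeW => t; rewrite indicE.
  have [tA|_] := boolP (t \in A); last by rewrite mulr0 normr0.
  by rewrite mulr1 fb//; exact: set_mem.
have br1 : 1 < `|b / r|.
  by rewrite normrM normfV (gtr0_norm r0) ltr_pdivlMr// mul1r.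
have := luxemburg_radii_indic_ge mA (ltW rb) (fun t _ => exponent_ge1 p t) br.
rewrite powRr1//; apply/negP; rewrite -ltNge.
apply: (@lt_le_trans _ _ (`|b / r|)%:E); first by rewrite lte_fin.
by rewrite -[leLHS]mule1 lee_wpmul2l// lee_fin.
Qed.

End indicator.

(** * Necessity of q <= p for the inclusion *)

Section inclusion.
Context {d : measure_display} {T : measurableType d} {R : realType}.
Variables (mu : {measure set T -> \bar R}) (p q : exponent T R).
Hypothesis mu_na : non_atomic mu.
Variable incl : {subset Lvar_pred mu p <= Lvar_pred mu q}.
Hypothesis incl_cont : continuous (Lvar_incl incl).

Lemma Lvar_incl_bounded :
  exists2 C : R, 0 < C & forall x, `|Lvar_incl incl x| <= C * `|x|.
Proof.
have /linear_boundedP h := @continuous_linear_bounded _ _ _ 0 (Lvar_incl incl)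
  (@incl_cont 0).
near (+oo : set_system R) => C; exists C; last by near: C.
by near: C; exact: nbhs_pinfty_gt.
Unshelve. all: by end_near. Qed.

(** Multiples of indicators of small sets B: with a = mu(B)^(-1/u) the function
a 1_B stays in the unit ball of L^p, while a^v mu(B) = a^(v - u) is
unbounded. *)
Lemma exponent_gap_null (u v : R) (A : set T) : measurable A -> u < v ->
  (forall t, A t -> p t <= u /\ v <= q t) -> mu A = 0%E.
Proof.
move=> mA uv Auv; apply/eqP; rewrite eq_le measure_ge0 andbT leNgt.
apply/negP => A0.
(* A is nonempty, and exponents are at least 1. *)
have u1 : 1 <= u.
  have [A_0|/set0P[t /Auv[+ _]]] := eqVneq A set0.
    by move: A0; rewrite A_0 measure0 ltxx.
  exact/le_trans/exponent_ge1.
have u0 : 0 < u by exact: lt_le_trans u1.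
have [C C0 inclC] := Lvar_incl_bounded.
pose K := C + 1.
have K0 : 0 < K by rewrite addr_gt0.
have vu0 : 0 < v - u by rewrite subr_gt0.
(* For a >= M, the bound (a / K)^v a^(-u) <= 1, which is equivalent to
   a <= K^(v / (v - u)), fails. The summand K + 1 ensures that a exceeds the
   radii 1 and K, as the comparison of modulars needs bases at least 1. *)
pose M := K + 1 + K `^ (v / (v - u)).
have M0 : 0 < M by rewrite ltr_wpDr ?powR_ge0// addr_gt0.
have [B [mB BA B0 Bsmall]] := non_atomic_small mu_na mA A0 (powR_gt0 (- u) M0).
have Boo : (mu B < +oo)%E by rewrite (le_lt_trans Bsmall)// ltry.
pose m := fine (mu B).
have mE : mu B = m%:E by rewrite fineK// ge0_fin_numE.
have m0 : 0 < m by rewrite -lte_fin -mE.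
pose a := m `^ (- u^-1).
have a0 : 0 < a by exact: powR_gt0.
have au : a `^ u = m^-1.
  by rewrite /a -powRrM mulNr mulVf ?gt_eqF// powR_inv1// ltW.
have Ma : M <= a.
  have : M `^ u <= a `^ u.
    rewrite au -[leLHS]invrK lef_pV2 ?posrE ?invr_gt0 ?powR_gt0//.
    by rewrite -powRN -lee_fin -mE.
  apply: contraTT; rewrite -!ltNge => aM.
  by apply: gt0_ltr_powR => //; rewrite nnegrE ltW.
have KM : K + 1 <= M by rewrite lerDl powR_ge0.
have Ka : K <= a by apply: le_trans Ma; apply: le_trans KM; rewrite lerDl.
have a1 : 1 <= a by apply: le_trans Ma; apply: le_trans KM; rewrite lerDr ltW.
have aE : `|a| = a by rewrite gtr0_norm.
have r1 : luxemburg_radii mu p (fun t => a * \1_B t) 1.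
  apply: (@luxemburg_radii_indic_le _ _ _ _ _ _ u) => //.
  - by rewrite ltr01 aE.
  - by move=> t /BA/Auv[].
  - by rewrite divr1 aE au mE -EFinM mulVf// gt_eqF.
have mf := @measurable_fun_scale_indic _ _ R a B mB.
pose x : Lvar mu p := MkLvar (L0_mk_Lvar mf r1).
have x1 : `|x| <= 1.
  apply: luxemburg_norm_le; apply: (luxemburg_radii_ae _ mf _ r1).
    exact: measurable_L0.
  exact: L0_mkE.
have xq : luxemburg_radii mu q (fun t => a * \1_B t) K.
  have xK : `|Lvar_incl incl x| < K.
    apply: (le_lt_trans (inclC x)); apply: (@le_lt_trans _ _ C).
      by rewrite ler_piMr// ltW.
    by rewrite ltrDl.
  apply: luxemburg_radii_ae (Lvar_norm_lt xK) => //.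
    exact: measurable_L0.
  by apply: filterS (L0_mkE mu mf) => t <-.
have := @luxemburg_radii_indic_ge _ _ _ mu q a v K B mB _ _ xq.
rewrite aE => /(_ Ka (fun t Bt => (Auv t (BA t Bt)).2)).
apply/negP; rewrite -ltNge mE -EFinM lte_fin gtr0_norm ?divr_gt0//.
rewrite powRM ?invr_ge0 ?(ltW a0) ?(ltW K0)//.
have -> : a `^ v = a `^ (v - u) * m^-1.
  by rewrite -au -powRD subrK// (gt_eqF a0) implybT.
have -> : K^-1 `^ v = (K `^ v)^-1.
  by rewrite -powR_inv1 ?ltW// -powRrM mulN1r powRN.
rewrite mulrAC divfK ?gt_eqF// ltr_pdivlMr ?powR_gt0// mul1r.
have -> : K `^ v = (K `^ (v / (v - u))) `^ (v - u).
  by rewrite -powRrM divfK// gt_eqF.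
apply: gt0_ltr_powR => //; rewrite ?nnegrE ?powR_ge0 ?(ltW a0)//.
by apply: lt_le_trans Ma; rewrite ltrDr addr_gt0.
Qed.

(** The set where p < q is the countable union, over the pairs of rationals
u < v, of the sets where p <= u and v <= q. *)
Lemma Lvar_incl_exponent_le : {ae mu, forall t, q t <= p t}.
Proof.
pose gap (uv : rat * rat) : set T :=
  [set t | p t <= ratr uv.1] `&` [set t | ratr uv.2 <= q t].
have mgap uv : measurable (gap uv).
  by apply: measurableI; rewrite -[X in measurable X]setTI;
    apply: measurable_fun_le => //; exact: measurable_exponent.
have gap0 (uv : rat * rat) : uv.1 < uv.2 -> mu (gap uv) = 0%E.
  move=> uv12; apply: (@exponent_gap_null (ratr uv.1) (ratr uv.2)) => //.
  by rewrite ltr_rat.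
have : {ae mu, forall t, forall n (uv : rat * rat), unpickle n = Some uv ->
    uv.1 < uv.2 -> ~ gap uv t}.
  apply: ae_foralln => n.
  case: (unpickle n) => [uv|]; last by apply: aeW => t.
  have [uv12|nuv] := boolP (uv.1 < uv.2); last first.
    by apply: aeW => t uv' [<-]; rewrite (negbTE nuv).
  exists (gap uv); split => //; first exact: gap0.
  by move=> t /=; apply: contra_notP => ngt uv' [<-].
apply: filterS => t Pt; rewrite leNgt; apply/negP => pq.
have [u] := rat_in_itvoo pq; rewrite in_itv/= => /andP[pu uq].
have [v] := rat_in_itvoo uq; rewrite in_itv/= => /andP[uv vq].
apply: (Pt (pickle (u, v)) (u, v)); first by rewrite pickleK.
  by rewrite -(ltr_rat R).
by split; exact: ltW.
Qed.

(** * Step functions on large disjoint sets *)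

Lemma step_value (F : nat -> set T) (b : nat -> R) n (j : nat) t :
  trivIset setT F -> (j < n)%N -> F j t ->
  \sum_(i < n) b i * \1_(F i) t = b j.
Proof.
move=> tF jn Fjt; rewrite (bigD1 (Ordinal jn))//= big1 ?addr0.
  by rewrite indicE mem_set// mulr1.
move=> i ij; rewrite indicE memNset ?mulr0// => Fit.
move/eqP: ij; apply; apply/val_inj => /=.
by apply: tF => //; exists t.
Qed.

(** A radius r of x in L^q bounds every coefficient, because mu (F i) >= 1. Then
|x / r| <= 1, where raising to the larger exponent p decreases the value, so r
is a radius of x in L^p. *)
Lemma Lvar_step_norm_le (F : nat -> set T) (b : nat -> R) n (x : Lvar mu p) :
  (forall i, measurable (F i)) -> trivIset setT F ->
  (forall i, (1 <= mu (F i))%E) ->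
  {ae mu, forall t, Lvar_val x t = \sum_(i < n) b i * \1_(F i) t} ->
  `|x| <= `|Lvar_incl incl x|.
Proof.
move=> mF tF F1 xE.
pose g t := \sum_(i < n) b i * \1_(F i) t.
have mg : measurable_fun setT g.
  by apply: measurable_sum => i; exact: measurable_fun_scale_indic.
apply/ler_addgt0Pr => e e0; set r := _ + e.
have xr : luxemburg_radii mu q (Lvar_val x) r.
  by apply: (@Lvar_norm_lt _ _ _ _ _ (Lvar_incl incl x)); rewrite ltrDl.
have r0 : 0 < r by case: xr.
have gq : luxemburg_radii mu q g r.
  apply: (luxemburg_radii_ae mg _ _ xr); first exact: measurable_L0.
  by apply: filterS xE => t ->.
have gr t : `|g t| <= r.
  have [[i Fit]|nF] := pselect (exists i : 'I_n, F i t).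
    rewrite /g (step_value _ tF (ltn_ord i) Fit).
    apply: (cst_on_le_radius mg (mF i) (F1 i) _ gq) => s Fis.
    exact: (step_value _ tF (ltn_ord i) Fis).
  rewrite /g big1 ?normr0 ?ltW// => i _.
  by rewrite indicE memNset ?mulr0// => Fit; apply: nF; exists i.
apply: luxemburg_norm_le.
apply: (luxemburg_radii_ae _ mg xE); first exact: measurable_L0.
have mgr : measurable_fun setT (fun t => g t / r) by exact: measurable_funM.
split => //; case: gq => _; apply: le_trans; rewrite unlock.
apply: ae_ge0_le_integral => //.
- by apply/measurable_EFinP/(measurable_normr_powR p mgr).
- by apply/measurable_EFinP/(measurable_normr_powR q mgr).
- apply: filterS Lvar_incl_exponent_le => t qp _; rewrite lee_fin.
  have [->|g0] := eqVneq (g t) 0.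
    by rewrite mul0r normr0 !powR0 ?gt_eqF// (lt_le_trans ltr01)// exponent_ge1.
  apply: ger_powR => //.
  rewrite normr_gt0 mulf_neq0 ?invr_eq0 ?(gt_eqF r0)//=.
  by rewrite normrM normfV (gtr0_norm r0) ler_pdivrMr// mul1r.
Qed.

End inclusion.

Section normalized_indicator.
Context {d : measure_display} {T : measurableType d} {R : realType}.
Variables (mu : {measure set T -> \bar R}) (p : exponent T R).

Lemma Lvar_indic (A : set T) : measurable A -> (mu A < +oo)%E ->
  exists x : Lvar mu p, {ae mu, forall t, Lvar_val x t = \1_A t}.
Proof.
move=> mA Aoo.
have mf : measurable_fun setT (\1_A : T -> R) by exact: measurable_indic.
have [r fr] : luxemburg_radii mu p (\1_A) !=set0.
  apply: (@luxemburg_radii_nonempty _ _ _ _ _ _ 1) => //.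
  apply: le_lt_trans Aoo; rewrite -[mu A]mul1e -integral_scale_indic// unlock.
  rewrite le_eqVlt; apply/orP; left; apply/eqP; apply: eq_integral => t _.
  rewrite divr1 -[\1_A t in LHS]mul1r normr_indic_powR ?exponent_ge1//.
  by rewrite normr1 powR1.
by exists (MkLvar (L0_mk_Lvar mf fr)); exact: L0_mkE.
Qed.

(** The indicator of A does not have norm 0: it equals 1 on A and mu A >= 1, so
all its radii are at least 1. *)
Lemma Lvar_normalized_indic (A : set T) : measurable A -> (1 <= mu A)%E ->
  (mu A < +oo)%E ->
  exists x : Lvar mu p, `|x| = 1 /\
    exists c : R, {ae mu, forall t, Lvar_val x t = c * \1_A t}.
Proof.
move=> mA A1 Aoo; have [x xE] := Lvar_indic mA Aoo.
have mf : measurable_fun setT (\1_A : T -> R) by exact: measurable_indic.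
have x0 : 0 < `|x|.
  rewrite lt_neqAle normr_ge0 andbT eq_sym; apply/eqP => x0.
  have x2 : `|x| < 2^-1 by rewrite x0 invr_gt0.
  have xr : luxemburg_radii mu p (\1_A) 2^-1.
    apply: (luxemburg_radii_ae mf _ _ (Lvar_norm_lt x2)).
      exact: measurable_L0.
    by apply: filterS xE => t ->.
  have : `|1 : R| <= 2^-1.
    by apply: (cst_on_le_radius mf mA A1 _ xr) => t At; rewrite indicE mem_set.
  by rewrite normr1; lra.
exists (`|x|^-1 *: x); split.
  by rewrite normrZ normfV normr_id mulVf// gt_eqF.
exists `|x|^-1; apply: filter_app xE.
by apply: filterS (L0_scaleE `|x|^-1 (Lvar_val x)) => t -> ->.
Qed.

Lemma Lvar_sumE (f : nat -> Lvar mu p) (g : nat -> T -> R) (a : nat -> R) n :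
  (forall i, {ae mu, forall t, Lvar_val (f i) t = g i t}) ->
  {ae mu, forall t, Lvar_val (\sum_(i < n) a i *: f i) t =
    \sum_(i < n) a i * g i t}.
Proof.
move=> fg; elim: n => [|n IH].
  rewrite big_ord0; apply: filterS (L0_zeroE mu) => t /= ->.
  by rewrite big_ord0.
rewrite big_ord_recr/=.
apply: filter_app (L0_addE (Lvar_val (\sum_(i < n) a i *: f i))
  (Lvar_val (a n *: f n))).
apply: filter_app (L0_scaleE (a n) (Lvar_val (f n))).
apply: filter_app IH; apply: filterS (fg n) => t fE SE aE DE.
by rewrite big_ord_recr/= -SE -fE -aE -DE.
Qed.

Lemma Lvar_indic_disjoint (A B : set T) (x y : Lvar mu p) (a b : R) :
  A `&` B = set0 -> {ae mu, forall t, Lvar_val x t = a * \1_A t} ->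
  {ae mu, forall t, Lvar_val y t = b * \1_B t} -> lat_disjoint x y.
Proof.
move=> AB xE yE; apply/val_inj/L0_eqP => /=.
apply: filter_app (L0_meetE (L0_join (Lvar_val x) (- Lvar_val x))
  (L0_join (Lvar_val y) (- Lvar_val y))).
apply: filter_app (L0_zeroE mu); apply: filter_app xE; apply: filter_app yE.
apply: filter_app (L0_absE (Lvar_val x)).
apply: filterS (L0_absE (Lvar_val y)) => t yA xA yE xE zE mE.
rewrite zE; apply: (etrans mE); rewrite yA xA xE yE !indicE.
have [tA|_] := boolP (t \in A); last first.
  by rewrite mulr0 normr0; apply: min_l.
rewrite memNset; last first.
  by move=> Bt; rewrite -[False]/(set0 t) -AB; split => //; exact: set_mem.
by rewrite mulr0 normr0; apply: min_r.
Qed.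

End normalized_indicator.

Theorem theorem6p3 (d : measure_display) (T : measurableType d) (R : realType)
    (mu : {measure set T -> \bar R}) (p q : exponent T R)
    (mu_na : non_atomic mu) (mu_infty : mu setT = +oo%E)
    (incl : {subset Lvar_pred mu p <= Lvar_pred mu q})
    (incl_cont : continuous (Lvar_incl incl)) :
  ~ disjointly_strictly_singular (Lvar_incl incl).
Proof.
apply; have [F [mF _ tF F1]] :=
  non_atomic_disjoint_large mu_na measurableT mu_infty.
have [f fP] := choice (fun n =>
  Lvar_normalized_indic p (mF n) (F1 n).1 (F1 n).2).
have [c fE] := choice (fun n => (fP n).2).
exists f; split => [n|n m nm|].
- exact: (fP n).1.
- apply: Lvar_indic_disjoint (fE n) (fE m).
  by move/trivIsetP : tF; exact.
- apply: (@isomorphism_on_bounded_below _ _ _ _ _ 1) => // n a.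
  rewrite mul1r.
  apply: (@Lvar_step_norm_le _ _ _ _ _ _ mu_na _ incl_cont F
    (fun i => a i * c i) n) => //; first by move=> i; exact: (F1 i).1.
  by apply: filterS (Lvar_sumE a n fE) => t ->; under eq_bigr do rewrite mulrA.
Qed.
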